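(* Let $c>0$ and $\eta>0$. For $j=1,2$ let $q_j\in\mathrm{span}\{\psi_{m,n,\ell}(\cdot;c): |\alpha_{m,n}(c)|>\eta\}$ and let $u_{b,j}$ be the processed Born data $$u_{b,j}(p)=\int_B e^{ic\,p\cdot y}q_j(y)\,dy,\qquad p\in B .$$ Then for the contrasts reconstructed from the data by $$q_j=\sum_{|\alpha_{m,n}(c)|\ge\eta}\frac{1}{\alpha_{m,n}(c)}\,\langle u_{b,j},\psi_{m,n,\ell}(\cdot;c)\rangle_B\,\psi_{m,n,\ell}(\cdot;c),\qquad j=1,2,$$ the following Lipschitz stability holds: $$\|q_1-q_2\|_{L^2(B)}\le\frac1\eta\,\|u_{b,1}-u_{b,2}\|_{L^2(B)} .$$
   Context: $B=B(0,1)\subset\mathbb{R}^2$ is the unit disk; $c=2k$ where $k>0$ is the wave number. $L^2(B)$ is complex-valued and spans are over $\mathbb{C}$. $\langle u,\psi\rangle_B=\int_B u(x)\psi(x)\,dx$ for real-valued $\psi$. Disk prolate spheroidal wave functions (disk PSWFs): $\mathbb{N}=\{0,1,2,\dots\}$, $\mathbb{I}(0)=\{1\}$ and $\mathbb{I}(m)=\{1,2\}$ for $m\ge1$. The family $\{\psi_{m,n,\ell}(\cdot;c)\}_{m,n\in\mathbb{N},\,\ell\in\mathbb{I}(m)}$ is a complete orthonormal system of $L^2(B)$ consisting of real-valued eigenfunctions of the restricted Fourier transform, $$\int_B e^{ic\,x\cdot y}\psi_{m,n,\ell}(y;c)\,dy=\alpha_{m,n}(c)\,\psi_{m,n,\ell}(x;c),\quad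 x\in B,$$ of the form $\psi_{m,n,\ell}(x;c)=r^m\varphi_{m,n}(2r^2-1;c)\,Y_{m,\ell}(\hat x)$ with $x=r\hat x$, $\hat x=(\cos\theta,\sin\theta)$, $Y_{0,1}=1/\sqrt{2\pi}$, $Y_{m,1}=\cos(m\theta)/\sqrt{\pi}$, $Y_{m,2}=\sin(m\theta)/\sqrt{\pi}$ for $m\ge1$. For each fixed $m$ the index $n$ orders the eigenvalues so that $|\alpha_{m,0}(c)|>|\alpha_{m,1}(c)|>\cdots>0$; all $\alpha_{m,n}(c)$ are nonzero and $|\alpha_{m,n}(c)|\to0$ as $m,n\to\infty$. Sums and spans run over all $(m,n,\ell)$, $\ell\in\mathbb{I}(m)$, satisfying the indicated condition on $|\alpha_{m,n}(c)|$. *)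

(* Defs.v *)
From mathcomp Require Export all_boot all_order all_algebra finmap.
From mathcomp Require Export all_classical all_reals all_analysis.
From mathcomp Require Export complex.

Set Implicit Arguments.
Unset Strict Implicit.
Unset Printing Implicit Defensive.

Export Order.TTheory GRing.Theory Num.Theory.
Export numFieldNormedType.Exports.

Local Open Scope classical_set_scope.
Local Open Scope ring_scope.
Local Open Scope complex_scope.

(* R * R with its Borel sigma-algebra, the domain of mu2. *)
Notation borel_plane R := (measurableTypeR R * measurableTypeR R)%type.

Definition mu2 (R : realType) : {measure set (borel_plane R) -> \bar R} :=
  (@lebesgue_measure R \x @lebesgue_measure R)%E.

(* The open disk B(0, 1). *)
Definition disk (R : realType) : set (R * R) :=
  [set x | x.1 ^+ 2 + x.2 ^+ 2 < 1].
Arguments disk : clear implicits.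

(* Meaningful for f integrable on the disk, in particular for f in L^2(B). *)
Definition integral_disk (R : realType) (f : R * R -> R[i]) : R[i] :=
  (\int[mu2 R]_(x in disk R) complex.Re (f x))%R +i*
  (\int[mu2 R]_(x in disk R) complex.Im (f x))%R.

Definition L2norm_disk (R : realType) (f : R * R -> R[i]) : \bar R :=
  Lnorm (mu2 R) 2%:E ((fun x => (Normc.normc (f x))%:E) \_ (disk R)).

(* Representatives of the elements of L^2(B); only the values on B matter. *)
Definition L2_disk (R : realType) : set (R * R -> R[i]) :=
  [set f | [/\ measurable_fun (disk R : set (borel_plane R))
                 (fun x => complex.Re (f x)),
               measurable_fun (disk R : set (borel_plane R))
                 (fun x => complex.Im (f x)) &
               (L2norm_disk f < +oo)%E]].

Definition eq_disk (R : realType) (f g : R * R -> R[i]) : Prop :=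
  {ae mu2 R, forall x, disk R x -> f x = g x}.

(* No conjugation: psi is real-valued. *)
Definition pairing_disk (R : realType) (u : R * R -> R[i]) (psi : R * R -> R) :
    R[i] :=
  integral_disk (fun x => u x * (psi x)%:C).

Definition expi (R : realType) (t : R) : R[i] := cos t +i* sin t.

Definition fourier_disk (R : realType) (c : R) (q : R * R -> R[i])
    (p : R * R) : R[i] :=
  integral_disk (fun y => expi (c * (p.1 * y.1 + p.2 * y.2)) * q y).

(* Triples (m, n, l). *)
Notation pswf_index := (nat * nat * nat)%type.

Definition angular_index (m : nat) : set nat :=
  if m == 0%N then [set 1%N] else [set 1%N; 2%N].

Definition pswf_indices : set pswf_index :=
  [set i | angular_index i.1.1 i.2].

(* Only used for l in angular_index m. *)
Definition angular (R : realType) (m l : nat) (theta : R) : R :=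
  if m == 0%N then 1 / Num.sqrt (2 * pi)
  else if l == 1%N then cos (m%:R * theta) / Num.sqrt pi
  else sin (m%:R * theta) / Num.sqrt pi.

(* The complex linear span, as a subset of L^2(B), of the psi i with i in A. *)
Definition span_disk (R : realType) (psi : pswf_index -> R * R -> R)
    (A : set pswf_index) : set (R * R -> R[i]) :=
  [set q | L2_disk q /\
    exists (D : {fset pswf_index}) (a : pswf_index -> R[i]),
      (forall i, i \in D -> A i) /\
      eq_disk q (fun x => \sum_(i <- D) a i * (psi i x)%:C)].

Record disk_PSWF (R : realType) (c : R) (psi : pswf_index -> R * R -> R)
    (alpha : nat -> nat -> R[i]) : Prop := DiskPSWF {
  pswf_L2 : forall i, pswf_indices i -> L2_disk (fun x => (psi i x)%:C) ;
  pswf_orthonormal : forall i j, pswf_indices i -> pswf_indices j ->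
    pairing_disk (fun x => (psi i x)%:C) (psi j) = (i == j)%:R ;
  pswf_complete : forall f, L2_disk f -> forall e : R, 0 < e ->
    exists2 g, span_disk psi pswf_indices g &
      (L2norm_disk (fun x => f x - g x)%R < e%:E)%E ;
  pswf_eigen : forall m n l, angular_index m l -> forall x, disk R x ->
    fourier_disk c (fun y => (psi (m, n, l) y)%:C) x =
    alpha m n * (psi (m, n, l) x)%:C ;
  pswf_polar : exists phi : nat -> nat -> R -> R,
    forall m n l, angular_index m l -> forall r theta : R, 0 <= r < 1 ->
      psi (m, n, l) (r * cos theta, r * sin theta) =
      r ^+ m * phi m n (2 * r ^+ 2 - 1) * angular m l theta ;
  pswf_neq0 : forall m n, alpha m n != 0 ;
  pswf_decreasing : forall m n,
    Normc.normc (alpha m n.+1) < Normc.normc (alpha m n) ;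
  (* alpha m n --> 0 as (m, n) leaves every finite set *)
  pswf_decay : forall e : R, 0 < e ->
    finite_set [set mn : nat * nat | e <= Normc.normc (alpha mn.1 mn.2)]
}.

Definition indices_gt (R : realType) (alpha : nat -> nat -> R[i]) (eta : R) :
    set pswf_index :=
  [set i | pswf_indices i /\ eta < Normc.normc (alpha i.1.1 i.1.2)].

Definition indices_ge (R : realType) (alpha : nat -> nat -> R[i]) (eta : R) :
    set pswf_index :=
  [set i | pswf_indices i /\ eta <= Normc.normc (alpha i.1.1 i.1.2)].

(* The sum is finite as soon as alpha satisfies pswf_decay and 0 < eta. *)
Definition reconstruction (R : realType) (psi : pswf_index -> R * R -> R)
    (alpha : nat -> nat -> R[i]) (eta : R) (u : R * R -> R[i]) :
    R * R -> R[i] :=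
  fun x => \sum_(i \in indices_ge alpha eta)
    (alpha i.1.1 i.1.2)^-1 * pairing_disk u (psi i) * (psi i x)%:C.

(* Main.v *)
Require Import Defs.
From mathcomp Require Import measurable_realfun lra ring.

(** The operator q |-> u_b is diagonal in the orthonormal system psi, with
    eigenvalues alpha. Since only finitely many |alpha_{m,n}| are >= eta, q_1
    and q_2 are finite sums of a_i psi_i over these indices, hence u_{b,j} is
    the finite sum of a_i alpha_i psi_i on the disk: pairing with psi_i and
    dividing by alpha_i gives back a_i. By the Pythagorean identity the two
    norms are those of the coefficient vectors (a_i) and (a_i alpha_i), and
    |alpha_i| >= eta. *)

Set Implicit Arguments.
Unset Strict Implicit.
Unset Printing Implicit Defensive.

Local Open Scope classical_set_scope.
Local Open Scope ring_scope.
Local Open Scope complex_scope.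

(** * The disk as a measurable set of finite measure, and equality almost everywhere on it *)

Lemma measurable_disk (R : realType) :
  measurable (disk R : set (borel_plane R)).
Proof.
have mf : measurable_fun [set: borel_plane R]
    (fun x : borel_plane R => x.1 ^+ 2 + x.2 ^+ 2).
  apply: measurable_funD; apply: measurable_funX.
    exact: measurable_fst.
  exact: measurable_snd.
have -> : disk R = setT `&`
    (fun x : borel_plane R => x.1 ^+ 2 + x.2 ^+ 2) @^-1` `]-oo, 1[.
  by apply/seteqP; split => x /=; rewrite /disk /= in_itv/= => -[].
exact: mf.
Qed.

(** The disk lies in a square, whose product measure is finite. Finiteness makes constants
    integrable, hence square-integrable functions integrable. *)
Lemma mu2_disk_lty (R : realType) : (mu2 R (disk R) < +oo)%E.
Proof.
pose I := `[(-1 : R), 1]%classic.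
have mI : measurable (I : set (measurableTypeR R)) by exact: measurable_itv.
have sub : disk R `<=` I `*` I.
  move=> x; rewrite /disk /= => x1.
  by split; rewrite /I /= in_itv /=; apply/andP; split; nra.
apply: (@le_lt_trans _ _ (mu2 R (I `*` I))).
  apply: le_measure => //; rewrite inE; first exact: measurable_disk.
  exact: measurableX.
have -> : mu2 R (I `*` I) =
    (@lebesgue_measure R I * @lebesgue_measure R I)%E.
  exact: product_measure1E.
rewrite lebesgue_measure_itv /=.
by case: ifP => _; rewrite ?mule0// -EFinB -EFinM ltry.
Qed.

(* On subgoals about R * R rather than borel_plane R, filterS does not infer
   its Filter instance. *)
Lemma ae_mu2S (R : realType) (P Q : R * R -> Prop) :
  {ae mu2 R, forall x, P x} -> (forall x, P x -> Q x) ->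
  {ae mu2 R, forall x, Q x}.
Proof.
move=> aeP PQ.
have F : Filter (nbhs (almost_everywhere (mu2 R))) by typeclasses eauto.
exact: (@filterS _ _ F _ _ PQ).
Qed.

Lemma eq_diskB (R : realType) (f f' g g' : R * R -> R[i]) :
  eq_disk f f' -> eq_disk g g' ->
  eq_disk (fun x => f x - g x) (fun x => f' x - g' x).
Proof.
have F : Filter (nbhs (almost_everywhere (mu2 R))) by typeclasses eauto.
move=> ff' gg'; apply: (@filterS2 _ _ F _ _ _ _ ff' gg') => x e e' xD.
by rewrite e ?e'.
Qed.

Lemma ae_eq_Rintegral d (T : measurableType d) (R : realType)
    (mu : {measure set T -> \bar R}) (D : set T) (f g : T -> R) :
  measurable D -> measurable_fun D f -> measurable_fun D g ->
  {ae mu, forall x, D x -> f x = g x} ->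
  \int[mu]_(x in D) f x = \int[mu]_(x in D) g x.
Proof.
move=> mD mf mg fg; rewrite /Rintegral; congr fine; apply: ae_eq_integral => //.
- exact/measurable_EFinP.
- exact/measurable_EFinP.
by apply: filterS fg => x /[apply] ->.
Qed.

(** * Measurability and integrability of complex-valued functions on the disk, by real and imaginary
    parts *)

Definition cmeasurable_disk (R : realType) (f : R * R -> R[i]) : Prop :=
  measurable_fun (disk R : set (borel_plane R)) (fun x => complex.Re (f x)) /\
  measurable_fun (disk R : set (borel_plane R)) (fun x => complex.Im (f x)).

Definition cintegrable_disk (R : realType) (f : R * R -> R[i]) : Prop :=
  (mu2 R).-integrable (disk R) (EFin \o (fun x => complex.Re (f x))) /\
  (mu2 R).-integrable (disk R) (EFin \o (fun x => complex.Im (f x))).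

Lemma eq_complexP (R : realType) (z w : R[i]) :
  complex.Re z = complex.Re w -> complex.Im z = complex.Im w -> z = w.
Proof. by case: z w => a b [c d] /= -> ->. Qed.

Lemma ReD (R : realType) (z w : R[i]) :
  complex.Re (z + w) = complex.Re z + complex.Re w.
Proof. by case: z; case: w. Qed.

Lemma ImD (R : realType) (z w : R[i]) :
  complex.Im (z + w) = complex.Im z + complex.Im w.
Proof. by case: z; case: w. Qed.

Lemma ReM (R : realType) (z w : R[i]) :
  complex.Re (z * w) =
    complex.Re z * complex.Re w - complex.Im z * complex.Im w.
Proof. by case: z; case: w. Qed.

Lemma ImM (R : realType) (z w : R[i]) :
  complex.Im (z * w) =
    complex.Re z * complex.Im w + complex.Im z * complex.Re w.
Proof. by case: z; case: w. Qed.

Lemma cmeasurable_diskD (R : realType) (f g : R * R -> R[i]) :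
  cmeasurable_disk f -> cmeasurable_disk g ->
  cmeasurable_disk (fun x => f x + g x).
Proof.
move=> [f1 f2] [g1 g2]; split.
  by under eq_fun do rewrite ReD; exact: measurable_funD.
by under eq_fun do rewrite ImD; exact: measurable_funD.
Qed.

Lemma cmeasurable_diskM (R : realType) (f g : R * R -> R[i]) :
  cmeasurable_disk f -> cmeasurable_disk g ->
  cmeasurable_disk (fun x => f x * g x).
Proof.
move=> [f1 f2] [g1 g2]; split.
  by under eq_fun do rewrite ReM; apply: measurable_funB;
    exact: measurable_funM.
by under eq_fun do rewrite ImM; apply: measurable_funD;
  exact: measurable_funM.
Qed.

Lemma cmeasurable_disk_cst (R : realType) (a : R[i]) :
  cmeasurable_disk (fun _ : R * R => a).
Proof. by split; exact: measurable_cst. Qed.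

Lemma cmeasurable_disk_sum (R : realType) (I : choiceType) (s : seq I)
    (F : I -> R * R -> R[i]) :
  (forall i, i \in s -> cmeasurable_disk (F i)) ->
  cmeasurable_disk (fun x => \sum_(i <- s) F i x).
Proof.
elim: s => [_|i s ih Fs].
  by under eq_fun do rewrite big_nil; exact: cmeasurable_disk_cst.
under eq_fun do rewrite big_cons.
apply: cmeasurable_diskD; first by apply: Fs; rewrite mem_head.
by apply: ih => j js; apply: Fs; rewrite inE js orbT.
Qed.

Lemma cmeasurable_disk_expi (R : realType) (c : R) (p : R * R) :
  cmeasurable_disk (fun y => expi (c * (p.1 * y.1 + p.2 * y.2))).
Proof.
have m : measurable_fun (disk R : set (borel_plane R))
    (fun y : borel_plane R => c * (p.1 * y.1 + p.2 * y.2)).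
  apply: measurable_funTS; apply: measurable_funM; first exact: measurable_cst.
  apply: measurable_funD; apply: measurable_funM;
    first [exact: measurable_cst|exact: measurable_fst|exact: measurable_snd].
split => /=.
  apply: (measurableT_comp _ m); apply: continuous_measurable_fun;
  exact: continuous_cos.
apply: (measurableT_comp _ m); apply: continuous_measurable_fun;
  exact: continuous_sin.
Qed.

(** Serves to derive the measurability of the data, which are given only by their values on the
    disk. *)
Lemma eq_cmeasurable_disk (R : realType) (f g : R * R -> R[i]) :
  (forall x, disk R x -> f x = g x) -> cmeasurable_disk g -> cmeasurable_disk f.
Proof.
move=> fg [g1 g2]; split.
  by apply: eq_measurable_fun g1 => x; rewrite inE => /fg ->.
by apply: eq_measurable_fun g2 => x; rewrite inE => /fg ->.
Qed.

Lemma cintegrable_disk_measurable (R : realType) (f : R * R -> R[i]) :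
  cintegrable_disk f -> cmeasurable_disk f.
Proof.
by move=> [/integrableP[/measurable_EFinP f1 _]
  /integrableP[/measurable_EFinP f2 _]].
Qed.

Lemma cintegrable_diskD (R : realType) (f g : R * R -> R[i]) :
  cintegrable_disk f -> cintegrable_disk g ->
  cintegrable_disk (fun x => f x + g x).
Proof.
have mD := @measurable_disk R.
move=> [f1 f2] [g1 g2]; split.
  apply: (eq_integrable mD _ _ _ (integrableD mD f1 g1)) => x _ /=.
  by rewrite ReD.
apply: (eq_integrable mD _ _ _ (integrableD mD f2 g2)) => x _ /=.
by rewrite ImD.
Qed.

Lemma cintegrable_diskZ (R : realType) (a : R[i]) (f : R * R -> R[i]) :
  cintegrable_disk f -> cintegrable_disk (fun x => a * f x).
Proof.
have mD := @measurable_disk R.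
move=> [f1 f2]; split.
  apply: (eq_integrable mD _ _ _ (integrableB mD
    (integrableZl mD (complex.Re a) f1) (integrableZl mD (complex.Im a) f2)))
    => x _ /=.
  by rewrite ReM.
apply: (eq_integrable mD _ _ _ (integrableD mD
  (integrableZl mD (complex.Re a) f2) (integrableZl mD (complex.Im a) f1)))
  => x _ /=.
by rewrite ImM.
Qed.

(** * Linearity of the complex integral *)

Lemma integral_diskD (R : realType) (f g : R * R -> R[i]) :
  cintegrable_disk f -> cintegrable_disk g ->
  integral_disk (fun x => f x + g x) = integral_disk f + integral_disk g.
Proof.
have mD := @measurable_disk R.
move=> [f1 f2] [g1 g2]; apply: eq_complexP; rewrite ?ReD ?ImD /=.
  by under eq_Rintegral do rewrite ReD; rewrite RintegralD.
by under eq_Rintegral do rewrite ImD; rewrite RintegralD.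
Qed.

Lemma integral_diskZ (R : realType) (a : R[i]) (f : R * R -> R[i]) :
  cintegrable_disk f ->
  integral_disk (fun x => a * f x) = a * integral_disk f.
Proof.
have mD := @measurable_disk R.
move=> [f1 f2]; apply: eq_complexP; rewrite ?ReM ?ImM /=.
  under eq_Rintegral do rewrite ReM.
  rewrite RintegralB ?RintegralZl//.
    exact: (integrableZl mD _ f1).
  exact: (integrableZl mD _ f2).
under eq_Rintegral do rewrite ImM.
rewrite RintegralD ?RintegralZl//.
  exact: (integrableZl mD _ f2).
exact: (integrableZl mD _ f1).
Qed.

(** Integrability and value are proved together, since additivity in the induction step needs the
    tail to be integrable. *)
Lemma integral_disk_sum (R : realType) (I : choiceType) (s : seq I)
    (a : I -> R[i]) (F : I -> R * R -> R[i]) :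
  (forall i, i \in s -> cintegrable_disk (F i)) ->
  cintegrable_disk (fun x => \sum_(i <- s) a i * F i x) /\
  integral_disk (fun x => \sum_(i <- s) a i * F i x) =
    \sum_(i <- s) a i * integral_disk (F i).
Proof.
elim: s => [_|i s ih Fs].
  under eq_fun do rewrite big_nil; rewrite big_nil; split.
    by split; exact: integrable0.
  by apply: eq_complexP => /=; rewrite /Rintegral integral0.
under eq_fun do rewrite big_cons; rewrite big_cons.
have Fi : cintegrable_disk (F i) by apply: Fs; rewrite mem_head.
have [|h1 <-] := ih; first by move=> j js; apply: Fs; rewrite inE js orbT.
split; first by apply: cintegrable_diskD => //; exact: cintegrable_diskZ.
by rewrite integral_diskD ?integral_diskZ//; exact: cintegrable_diskZ.
Qed.

(** Both functions are assumed measurable: for the Borel sigma-algebra, equality almost everywhere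
    does not transfer measurability. *)
Lemma eq_integral_disk (R : realType) (f g : R * R -> R[i]) :
  cmeasurable_disk f -> cmeasurable_disk g -> eq_disk f g ->
  integral_disk f = integral_disk g.
Proof.
have mD := @measurable_disk R.
move=> [f1 f2] [g1 g2] fg; apply: eq_complexP => /=;
  apply: ae_eq_Rintegral => //.
  by apply: (ae_mu2S fg) => x /[apply] ->.
by apply: (ae_mu2S fg) => x /[apply] ->.
Qed.

(** * The norm, and integrability of products of square-integrable functions *)

Lemma L2norm_diskE (R : realType) (f : R * R -> R[i]) :
  L2norm_disk f = ((\int[mu2 R]_(x in disk R)
    (complex.Re (f x) ^+ 2 + complex.Im (f x) ^+ 2)%:E) `^ 2^-1)%E.
Proof.
rewrite /L2norm_disk unlock /=; congr (_ `^ _)%E.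
rewrite [RHS]integral_mkcond; apply: eq_integral => x _; rewrite !patchE.
(* Outside the disk the restricted function is 0, and its power vanishes because the exponent 2 is
   nonzero. *)
case: ifP => _; last by rewrite abse0 poweR0r// pnatr_eq0.
case: (f x) => a b /=; rewrite ger0_norm ?sqrtr_ge0//.
by rewrite (powR_mulrn 2) ?sqrtr_ge0// sqr_sqrtr// addr_ge0// sqr_ge0.
Qed.

Lemma L2_disk_real (R : realType) (f : R * R -> R) :
  L2_disk (fun x => (f x)%:C) ->
  measurable_fun (disk R : set (borel_plane R)) f /\
  (mu2 R).-integrable (disk R) (EFin \o (fun x => f x ^+ 2)).
Proof.
move=> [/= mf _]; rewrite L2norm_diskE /= => fy; split => //.
apply/integrableP; split.
  by apply/measurable_EFinP; exact: measurable_funX.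
under eq_integral => x _ do rewrite /= ger0_norm ?sqr_ge0//.
(* If the integral of the square were infinite, so would be its square root, the norm. *)
rewrite ltey; apply/eqP => Ey; move: fy.
under eq_integral => x _ do rewrite expr0n addr0.
by rewrite Ey poweRyr.
Qed.

(** Domination: $|fg| \le f^2 + g^2$. *)
Lemma integrable_mul_sqr (R : realType) (f g : R * R -> R) :
  measurable_fun (disk R : set (borel_plane R)) f ->
  measurable_fun (disk R : set (borel_plane R)) g ->
  (mu2 R).-integrable (disk R) (EFin \o (fun x => f x ^+ 2)) ->
  (mu2 R).-integrable (disk R) (EFin \o (fun x => g x ^+ 2)) ->
  (mu2 R).-integrable (disk R) (EFin \o (fun x => f x * g x)).
Proof.
have mD := @measurable_disk R.
move=> mf mg f2 g2; apply: (le_integrable mD _ _ (integrableD mD f2 g2)).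
  by apply/measurable_EFinP; exact: measurable_funM.
move=> x _ /=; rewrite lee_fin (ger0_norm (addr_ge0 _ _)) ?sqr_ge0//.
by rewrite ler_norml; apply/andP; split; nra.
Qed.

(** The product lemma with second factor 1, which is square-integrable as the disk has finite
    measure. *)
Lemma integrable_sqr (R : realType) (f : R * R -> R) :
  measurable_fun (disk R : set (borel_plane R)) f ->
  (mu2 R).-integrable (disk R) (EFin \o (fun x => f x ^+ 2)) ->
  (mu2 R).-integrable (disk R) (EFin \o f).
Proof.
have mD := @measurable_disk R.
move=> mf f2.
have i1 : (mu2 R).-integrable (disk R) (EFin \o (fun=> 1 ^+ 2)).
  apply/integrableP; split; first exact: measurable_cst.
  under eq_integral => x _ do rewrite /= expr1n normr1.
  by rewrite integral_cst// mul1e; exact: mu2_disk_lty.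
apply: (eq_integrable mD _ _ _ (integrable_mul_sqr mf _ f2 i1)) => //=.
by move=> x _ /=; rewrite mulr1.
Qed.

(** Since $|\cos|, |\sin| \le 1$, both parts are dominated by $|f|$, which is integrable. *)
Lemma cintegrable_disk_expiM (R : realType) (c : R) (p : R * R)
    (f : R * R -> R) :
  L2_disk (fun x => (f x)%:C) ->
  cintegrable_disk (fun y => expi (c * (p.1 * y.1 + p.2 * y.2)) * (f y)%:C).
Proof.
have mD := @measurable_disk R.
move=> fL2; have [mf f2] := L2_disk_real fL2.
have fi := integrable_sqr mf f2.
have mfC : cmeasurable_disk (fun x => (f x)%:C).
  by split => //=; exact: measurable_cst.
have [m1 m2] := cmeasurable_diskM (cmeasurable_disk_expi c p) mfC.
split; apply: (le_integrable mD _ _ fi); try exact/measurable_EFinP.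
  move=> x _ /=; rewrite lee_fin mulr0 subr0 normrM ler_piMl//.
  exact: cos_max.
move=> x _ /=; rewrite lee_fin mulr0 add0r normrM ler_piMl//.
exact: sin_max.
Qed.

Lemma cintegrable_disk_mul (R : realType) (f g : R * R -> R) :
  L2_disk (fun x => (f x)%:C) -> L2_disk (fun x => (g x)%:C) ->
  cintegrable_disk (fun x => (f x)%:C * (g x)%:C).
Proof.
have mD := @measurable_disk R.
move=> /L2_disk_real[mf f2] /L2_disk_real[mg g2]; split.
  apply: (eq_integrable mD _ _ _ (integrable_mul_sqr mf mg f2 g2)) => x _ /=.
  by rewrite mulr0 subr0.
apply: (eq_integrable mD _ _ _ (integrable0 _ _)) => x _ /=.
by rewrite mulr0 mul0r addr0.
Qed.

Lemma sqr_normcE (R : realType) (z : R[i]) :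
  Normc.normc z ^+ 2 = complex.Re z ^+ 2 + complex.Im z ^+ 2.
Proof. by case: z => a b /=; rewrite sqr_sqrtr// addr_ge0// sqr_ge0. Qed.

(** Links the extended-real integral in the norm to the real one in [integral_disk]; integrability
    keeps the former finite, so [fine] loses nothing. *)
Lemma cintegrable_disk_Re (R : realType) (f : R * R -> R[i]) :
  cintegrable_disk f ->
  (\int[mu2 R]_(x in disk R) (complex.Re (f x))%:E =
    (complex.Re (integral_disk f))%:E)%E.
Proof.
move=> [f1 _]; rewrite /= fineK//.
exact: (integrable_fin_num (@measurable_disk R) f1).
Qed.

(** * Finite expansions in the orthonormal system *)

(** The expansion of [q] holds only almost everywhere, but integration ignores null sets, so the
    result holds at every [p] of the disk, where the eigenvalue equation applies term by term. *)
Lemma fourier_disk_sum (R : realType) (c : R) (psi : pswf_index -> R * R -> R)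
    (alpha : nat -> nat -> R[i]) (s : seq pswf_index) (a : pswf_index -> R[i])
    (q : R * R -> R[i]) (p : R * R) :
  disk_PSWF c psi alpha -> (forall i, i \in s -> pswf_indices i) ->
  cmeasurable_disk q -> eq_disk q (fun x => \sum_(i <- s) a i * (psi i x)%:C) ->
  disk R p ->
  fourier_disk c q p = \sum_(i <- s) (a i * alpha i.1.1 i.1.2) * (psi i p)%:C.
Proof.
move=> H sP mq qE pD.
have /= [] := @integral_disk_sum R _ s a
    (fun i y => expi (c * (p.1 * y.1 + p.2 * y.2)) * (psi i y)%:C).
  by move=> i /sP iP; apply: cintegrable_disk_expiM; exact: (pswf_L2 H).
move=> h1 h2.
rewrite /fourier_disk (eq_integral_disk _ (cintegrable_disk_measurable h1)).
- rewrite h2 !big_seq; apply: eq_bigr => -[[m n] l] /sP iP /=.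
  by rewrite -mulrA -(@pswf_eigen _ _ _ _ H m n l iP p pD).
- by apply: cmeasurable_diskM => //; exact: cmeasurable_disk_expi.
- apply: (ae_mu2S qE) => x /[apply] ->.
  by rewrite mulr_sumr; apply: eq_bigr => i _; rewrite mulrCA.
Qed.

Lemma sum_delta (R : pzSemiRingType) (I : eqType) (s : seq I) (b : I -> R)
    (j : I) :
  uniq s -> j \in s -> \sum_(i <- s) b i * (i == j)%:R = b j.
Proof.
move=> us js; rewrite (bigD1_seq j)//= eqxx mulr1 big1 ?addr0// => i /negPf ->.
by rewrite mulr0.
Qed.

Lemma cmeasurable_disk_psi (R : realType) (c : R)
    (psi : pswf_index -> R * R -> R) (alpha : nat -> nat -> R[i])
    (i : pswf_index) :
  disk_PSWF c psi alpha -> pswf_indices i ->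
  cmeasurable_disk (fun x => (psi i x)%:C).
Proof. by move=> H /(pswf_L2 H) []. Qed.

Lemma cmeasurable_disk_psi_sum (R : realType) (c : R)
    (psi : pswf_index -> R * R -> R) (alpha : nat -> nat -> R[i])
    (s : seq pswf_index) (b : pswf_index -> R[i]) :
  disk_PSWF c psi alpha -> (forall i, i \in s -> pswf_indices i) ->
  cmeasurable_disk (fun x => \sum_(i <- s) b i * (psi i x)%:C).
Proof.
move=> H sP; apply: cmeasurable_disk_sum => i /sP iP.
apply: cmeasurable_diskM; first exact: cmeasurable_disk_cst.
exact: cmeasurable_disk_psi H iP.
Qed.

Lemma pairing_disk_sum (R : realType) (c : R) (psi : pswf_index -> R * R -> R)
    (alpha : nat -> nat -> R[i]) (s : seq pswf_index) (b : pswf_index -> R[i])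
    (u : R * R -> R[i]) (j : pswf_index) :
  disk_PSWF c psi alpha -> (forall i, i \in s -> pswf_indices i) ->
  uniq s -> j \in s ->
  (forall p, disk R p -> u p = \sum_(i <- s) b i * (psi i p)%:C) ->
  pairing_disk u (psi j) = b j.
Proof.
move=> H sP us js uE.
have jP := sP _ js.
have /= [] := @integral_disk_sum R _ s b
    (fun i y => (psi i y)%:C * (psi j y)%:C).
  by move=> i /sP iP; apply: cintegrable_disk_mul; exact: (pswf_L2 H).
move=> h1 h2.
have eqf p : disk R p -> u p * (psi j p)%:C =
    \sum_(i <- s) b i * ((psi i p)%:C * (psi j p)%:C).
  by move=> /uE ->; rewrite mulr_suml; apply: eq_bigr => i _; rewrite mulrA.
rewrite /pairing_disk (eq_integral_disk _ (cintegrable_disk_measurable h1)).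
(* Writing [b j] as a sum against the Kronecker delta lets orthonormality be applied term by
   term. *)
- rewrite h2 -[RHS](sum_delta b us js) !big_seq; apply: eq_bigr => i /sP iP.
  by rewrite -(pswf_orthonormal H iP jP).
- exact: eq_cmeasurable_disk eqf (cintegrable_disk_measurable h1).
- exact: aeW.
Qed.

(** Pythagorean identity: integrate $f \bar f$ as a double sum, in which orthonormality leaves only
    the diagonal terms. *)
Lemma L2norm_disk_sum (R : realType) (c : R) (psi : pswf_index -> R * R -> R)
    (alpha : nat -> nat -> R[i]) (s : seq pswf_index) (b : pswf_index -> R[i])
    (f : R * R -> R[i]) :
  disk_PSWF c psi alpha -> (forall i, i \in s -> pswf_indices i) -> uniq s ->
  cmeasurable_disk f -> eq_disk f (fun x => \sum_(i <- s) b i * (psi i x)%:C) ->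
  L2norm_disk f = (Num.sqrt (\sum_(i <- s) Normc.normc (b i) ^+ 2))%:E.
Proof.
move=> H sP us mf fE; rewrite L2norm_diskE.
(* [K i] is [psi i] times the conjugate of the expansion. Its integral is [(b i)^*], so the double
   sum is handled by two uses of [integral_disk_sum]. *)
pose K i x := \sum_(j <- s) (b j)^* * ((psi i x)%:C * (psi j x)%:C).
have h i : i \in s -> cintegrable_disk (K i) /\ integral_disk (K i) = (b i)^*.
  move=> js; have iP := sP _ js.
  have /= [] := @integral_disk_sum R _ s (fun j => (b j)^*)
      (fun j x => (psi i x)%:C * (psi j x)%:C).
    by move=> j /sP jP; apply: cintegrable_disk_mul; exact: (pswf_L2 H).
  move=> h1 h2; split => //; rewrite /K h2.
  rewrite -[RHS](sum_delta (fun j => (b j)^*) us js) !big_seq.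
  apply: eq_bigr => j /sP jP.
  by rewrite eq_sym -(pswf_orthonormal H iP jP).
have [h1 h2] := @integral_disk_sum R _ s b K (fun i iS => (h i iS).1).
have KE x : f x = \sum_(i <- s) b i * (psi i x)%:C ->
    \sum_(i <- s) b i * K i x = f x * (f x)^*.
  move=> fx; rewrite fx rmorph_sum mulr_suml; apply: eq_bigr => i _.
  rewrite !mulr_sumr; apply: eq_bigr => j _; rewrite rmorphM /=.
  transitivity (b i * (psi i x)%:C * ((b j)^* * (psi j x)%:C)); first by ring.
  (* Conjugation fixes [psi j], which is real-valued. *)
  by congr (_ * (_ * _)); exact/esym/conjc_real.
have sumE : complex.Re (\sum_(i <- s) b i * (b i)^*) =
    \sum_(i <- s) Normc.normc (b i) ^+ 2.
  elim: (s) => [|i t ih]; first by rewrite !big_nil.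
  rewrite !big_cons ReD ih sqr_normcE; case: (b i) => x y /=.
  by rewrite mulrN opprK !expr2.
have -> : (\int[mu2 R]_(x in disk R)
    (complex.Re (f x) ^+ 2 + complex.Im (f x) ^+ 2)%:E =
    (\sum_(i <- s) Normc.normc (b i) ^+ 2)%:E)%E.
  have -> : \sum_(i <- s) Normc.normc (b i) ^+ 2 =
      complex.Re (integral_disk (fun x => \sum_(i <- s) b i * K i x)).
    rewrite h2 -sumE; congr complex.Re; rewrite !big_seq.
    by apply: eq_bigr => i iS; rewrite (h i iS).2.
  rewrite -cintegrable_disk_Re//; apply: ae_eq_integral => //.
  - exact: measurable_disk.
  - case: mf => m1 m2; apply/measurable_EFinP/measurable_funD;
      exact: measurable_funX.
  - by have [m1 _] := cintegrable_disk_measurable h1; exact/measurable_EFinP.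
  apply: (ae_mu2S fE) => x /[apply] fx; congr EFin.
  by rewrite KE//; case: (f x) => x1 x2 /=; rewrite mulrN opprK !expr2.
rewrite poweR_EFin powR12_sqrt//; apply: sumr_ge0 => i _; exact: sqr_ge0.
Qed.

(** * Reduction to a fixed finite set of indices *)

(** Decay leaves finitely many pairs [(m, n)], and [l] is always 1 or 2. *)
Lemma finite_indices_ge (R : realType) (c eta : R)
    (psi : pswf_index -> R * R -> R) (alpha : nat -> nat -> R[i]) :
  disk_PSWF c psi alpha -> 0 < eta -> finite_set (indices_ge alpha eta).
Proof.
move=> H e0.
have fl : finite_set [set 1%N; 2%N] by exact: finite_set2.
apply: sub_finite_set (finite_setX (pswf_decay H e0) fl).
move=> -[[m n] l] [/= il ia].
split => //=; move: il; rewrite /pswf_indices /angular_index /=.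
by case: ifP => // _ ->; left.
Qed.

Lemma span_disk_expansion (R : realType) (psi : pswf_index -> R * R -> R)
    (A B : set pswf_index) (q : R * R -> R[i]) :
  A `<=` B -> finite_set B -> span_disk psi A q ->
  exists a : pswf_index -> R[i],
    eq_disk q (fun x => \sum_(i <- fset_set B) a i * (psi i x)%:C).
Proof.
move=> AB fB [_ [D [a [DA qE]]]].
(* Padding with zeros outside [D] makes the index set independent of [q]. *)
exists (fun i => if i \in D then a i else 0).
apply: (ae_mu2S qE) => x /[apply] ->.
have DB : (D `<=` fset_set B)%fset.
  by apply/fsubsetP => i /DA /AB iB; rewrite in_fset_set// inE.
rewrite -[RHS](big_fset_incl _ DB); last first.
  by move=> i _ /negPf ->; rewrite mul0r.
by rewrite big_seq [RHS]big_seq; apply: eq_bigr => i ->.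
Qed.

Theorem theorem4p4 (R : realType) (c eta : R) (hc : 0 < c) (heta : 0 < eta)
    (psi : pswf_index -> R * R -> R) (alpha : nat -> nat -> R[i])
    (hpsi : disk_PSWF c psi alpha)
    (q1 q2 u1 u2 : R * R -> R[i])
    (hq1 : span_disk psi (indices_gt alpha eta) q1)
    (hq2 : span_disk psi (indices_gt alpha eta) q2)
    (hu1 : forall p, disk R p -> u1 p = fourier_disk c q1 p)
    (hu2 : forall p, disk R p -> u2 p = fourier_disk c q2 p) :
  [/\ eq_disk q1 (reconstruction psi alpha eta u1),
      eq_disk q2 (reconstruction psi alpha eta u2) &
      (L2norm_disk (fun x => q1 x - q2 x)%R <=
         (1 / eta)%:E * L2norm_disk (fun x => u1 x - u2 x)%R)%E].
Proof.
have fin := finite_indices_ge hpsi heta.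
have gt_ge : indices_gt alpha eta `<=` indices_ge alpha eta.
  by move=> i [iP /ltW].
(* One list of indices serves both contrasts, so that differences can be taken coefficient by
   coefficient. *)
pose s : seq pswf_index := fset_set (indices_ge alpha eta).
have us : uniq s by exact: fset_uniq.
have sge i : i \in s -> indices_ge alpha eta i.
  by rewrite [_ \in _](in_fset_set fin) inE.
have sP i : i \in s -> pswf_indices i by move=> /sge[].
have data q u : span_disk psi (indices_gt alpha eta) q ->
    (forall p, disk R p -> u p = fourier_disk c q p) ->
    exists a, [/\ eq_disk q (fun x => \sum_(i <- s) a i * (psi i x)%:C),
      forall p, disk R p ->
        u p = \sum_(i <- s) (a i * alpha i.1.1 i.1.2) * (psi i p)%:C &
      eq_disk q (reconstruction psi alpha eta u)].
  move=> hq hu; have [a qE] := span_disk_expansion gt_ge fin hq.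
  have mq : cmeasurable_disk q by case: hq => -[].
  have uE p : disk R p ->
      u p = \sum_(i <- s) (a i * alpha i.1.1 i.1.2) * (psi i p)%:C.
    by move=> pD; rewrite hu// (fourier_disk_sum hpsi sP mq qE pD).
  exists a; split => //.
  apply: (ae_mu2S qE) => x /[apply] ->.
  (* By [fin], the sum over the set of indices is the sum over the list [s], as in the expansion of
     [q]; the terms are then compared one by one. *)
  rewrite /reconstruction fsbig_finite//= big_seq [RHS]big_seq.
  apply: eq_bigr => i iS.
  rewrite (pairing_disk_sum hpsi sP us iS uE).
  by rewrite mulrCA mulVf ?mulr1// (pswf_neq0 hpsi).
have [a1 [q1E u1E r1]] := data _ _ hq1 hu1.
have [a2 [q2E u2E r2]] := data _ _ hq2 hu2.
split => //.
have mN f : cmeasurable_disk f -> cmeasurable_disk (fun x => - f x).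
  move=> mf; under eq_fun do rewrite -mulN1r.
  exact: cmeasurable_diskM (cmeasurable_disk_cst _) mf.
rewrite (@L2norm_disk_sum _ c psi alpha s
  (fun i => a1 i - a2 i))//; last 2 first.
- case: hq1 => -[m1 m2 _ _]; case: hq2 => -[m3 m4 _ _].
  by apply: cmeasurable_diskD; [|apply: mN].
- apply: (ae_mu2S (eq_diskB q1E q2E)) => x /[apply] ->.
  by rewrite -sumrB; apply: eq_bigr => i _; rewrite mulrBl.
have uE p : disk R p -> u1 p - u2 p =
    \sum_(i <- s) ((a1 i - a2 i) * alpha i.1.1 i.1.2) * (psi i p)%:C.
  move=> pD; rewrite u1E// u2E// -sumrB.
  by apply: eq_bigr => i _; rewrite !mulrBl.
rewrite (@L2norm_disk_sum _ c psi alpha s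
  (fun i => (a1 i - a2 i) * alpha i.1.1 i.1.2))//; last 2 first.
(* Measurability of the data difference comes from its expansion on the disk. *)
- exact: eq_cmeasurable_disk uE (cmeasurable_disk_psi_sum _ hpsi sP).
- exact: aeW.
(* The factor [eta] is moved to the left and written as $\sqrt{\eta^2}$. Both sides are then square
   roots of sums, compared termwise using $\eta \le |\alpha_i|$. *)
rewrite -EFinM lee_fin mul1r ler_pdivlMl// -{1}(ger0_norm (ltW heta)).
rewrite -sqrtr_sqr -sqrtrM ?sqr_ge0// ler_wsqrtr//.
rewrite mulr_sumr !big_seq; apply: ler_sum => i /sge[_ ie].
rewrite Normc.normcM exprMn mulrC ler_wpM2l ?sqr_ge0// ler_pXn2r// nnegrE.
  exact: ltW.
exact: le_trans (ltW heta) ie.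
Qed.
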